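(* The node degree in an $n$-node ReCord with division parameter $k$ is $\Theta(k\log_k n)$. That is, there exist absolute constants $0<c_1\le c_2$ such that for all integers $k\ge 2$ and $c\ge 1$, with $n=k^c$, the number $H(n)$ of outgoing links of an arbitrary node of the $n$-node ReCord with parameter $k$ satisfies $c_1\,k\log_k n\le H(n)\le c_2\,k\log_k n$.
   Context: ReCord (static model). Let $k>1$ be an integer and $n=k^c$ with $c\ge 1$ an integer. The $n$ nodes are evenly spaced on the unit circle $[0,1)$, so they may be identified with $0,1,\dots,n-1$ (integers mod $n$), where node $s$ sits at position $s/n$ and the clockwise direction is the increasing direction. The clockwise distance from $s$ to $t$ is $(t-s) \bmod n$. For each node $s$, the ring is divided recursively, starting from $s$. The level-1 division splits the whole ring, starting at $s$ and going clockwise, into $k$ equal intervals numbered $1,\dots,k$ clockwise. The level-2 division splits interval $1$ of level 1 (the one closest to $s$) into $k$ equal intervals, numbered in the same way. This continues, always dividing the first interval of the previous level, until the interval nearest to $s$ has length $1/n$ (so it contains only $s$). There are $c=\log_k n$ levels, and the intervals at level $i$ have length $1/k^i$. Hence interval $j$ at level $i$ of node $s$ consists of the nodes at clockwise distance in $[(j-1)n/k^i,\ jn/k^i)$ from $s$. For each level $1\le i\le c$ and each interval $j\in\{2,\dots,k\}$ of that level, node $s$ chooses one node of that interval uniformly at random and sets up a unidirectional link to it. (Interval $1$ of each level is replaced by its subdivision at the next level; at the last level it contains only $s$.) All random choices, over all nodes and intervals, are independent. The resulting directed network is the $n$-node ReCord with parameter $k$. The node degree of $s$ is its number of outgoing links.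 *)

(* Defs.v *)
From mathcomp Require Import all_boot all_order all_algebra.
From mathcomp Require Import all_classical all_reals all_analysis.
Set Implicit Arguments.
Unset Strict Implicit.
Unset Printing Implicit Defensive.
Import Order.TTheory GRing.Theory Num.Theory.
Local Open Scope ring_scope.

Definition logb (R : realType) (b x : R) : R := ln x / ln b.

Definition node (k c : nat) : finType := 'I_(k ^ c).

(* Under the coercion to [nat], [s] and [t] are their own residues mod [n]. *)
Definition cw_dist (n : nat) (s t : 'I_n) : nat := ((t + n - s) %% n)%N.

(* An arc [(a, l)] stands for the clockwise distances [a, a + l) from a
   reference node, in units of 1/n of the circle. *)
Definition arc := (nat * nat)%type.

(* The [j]-th, counting from 1, of the [k] equal parts of [a]. The quotient is
   exact in all uses below: the lengths divided are k^c, ..., k. *)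
Definition arc_part (k : nat) (a : arc) (j : nat) : arc :=
  (a.1 + j.-1 * (a.2 %/ k), a.2 %/ k)%N.

Fixpoint first_arc (k c i : nat) : arc :=
  if i is i'.+1 then arc_part k (first_arc k c i') 1 else (0%N, (k ^ c)%N).

Definition level_arc (k c i j : nat) : arc :=
  arc_part k (first_arc k c i.-1) j.

Definition interval (k c : nat) (s : node k c) (i j : nat) : {set node k c} :=
  [set t | ((level_arc k c i j).1 <= cw_dist s t
            < (level_arc k c i j).1 + (level_arc k c i j).2)%N].

Lemma first_arcE (k c i : nat) : (0 < k)%N -> (i <= c)%N ->
  first_arc k c i = (0%N, (k ^ c %/ k ^ i)%N).
Proof.
move=> k0; elim: i => [|i IH] ic; first by rewrite /= expn0 divn1.
by rewrite /= IH ?(ltnW ic)// /arc_part /= mul0n addn0 -divnMA expnSr.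
Qed.

Lemma mem_interval (k c : nat) (s t : node k c) (i j : nat) :
  (0 < k)%N -> (0 < i <= c)%N -> (0 < j)%N ->
  (t \in interval s i j) =
  (j.-1 * (k ^ c %/ k ^ i) <= cw_dist s t < j * (k ^ c %/ k ^ i))%N.
Proof.
move=> k0 /andP[i0 ic] j0.
rewrite inE /level_arc first_arcE ?(leq_trans (leq_pred i))// /arc_part /=.
by rewrite add0n -divnMA -expnSr prednK// -mulSnr prednK.
Qed.

(* A slot [(s, i, j)] is the link of node [s] at level [i + 1] into interval
   [j + 2]: levels range over 1, ..., c and intervals over 2, ..., k. *)
Definition slot (k c : nat) : finType := (node k c * 'I_c * 'I_k.-1)%type.

Definition slot_interval (k c : nat) (x : slot k c) : {set node k c} :=
  interval x.1.1 x.1.2.+1 x.2.+2.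

(* The product rule over the whole family covers every subfamily, by taking
   [A i = setT] outside of it. *)
Definition mutually_independent (R : realType) (d : measure_display)
    (T : measurableType d) (P : probability T R) (I V : finType)
    (X : I -> T -> V) : Prop :=
  forall A : I -> {set V},
    P [set w | forall i, X i w \in A i]%classic =
    (\prod_(i : I) P [set w | X i w \in A i]%classic)%E.

Record record_choice (R : realType) (d : measure_display)
    (T : measurableType d) (P : probability T R) (k c : nat)
    (X : slot k c -> T -> node k c) : Prop := RecordChoice {
  choice_mem : forall x w, X x w \in slot_interval x ;
  choice_measurable : forall x t, measurable [set w | X x w = t]%classic ;
  choice_uniform : forall x t, t \in slot_interval x ->
    P [set w | X x w = t]%classic = ((#|slot_interval x|%:R)^-1)%:E ;
  choice_independent : mutually_independent P X }.

Definition record_network (k c : nat) (T : Type)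
    (X : slot k c -> T -> node k c) (w : T) : rel (node k c) :=
  fun s t => [exists i, exists j, X (s, i, j) w == t].

Definition out_degree (V : finType) (e : rel V) (s : V) : nat :=
  #|[set t | e s t]|.

(* Main.v *)
Require Import Defs.
From mathcomp Require Import all_boot all_order all_algebra.
From mathcomp Require Import all_classical all_reals all_analysis.
From mathcomp Require Import lra.
Import Order.TTheory GRing.Theory Num.Theory.
Local Open Scope ring_scope.

(** The intervals of the slots of a node are pairwise disjoint, so distinct slots
    give distinct links and the degree is exactly [c * (k - 1)], whatever the
    random choices. Disjointness holds because a slot can be read off the
    clockwise distance [d] of any point of its interval: the level is determined
    by the number of base-[k] digits of [d], the interval by the leading digit. *)

(** Levels and intervals of a slot are shifted by 1 and 2, and [k ^ c %/ k ^ i.+1] is the exact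
    power [k ^ (c - i.+1)]. *)
Lemma slot_interval_bounds (k c : nat) (s t : node k c) (i : 'I_c) (j : 'I_k.-1) :
  (0 < k)%N -> t \in slot_interval (s, i, j) ->
  (j.+1 * k ^ (c - i.+1) <= cw_dist s t < j.+2 * k ^ (c - i.+1))%N.
Proof.
by move=> k0; rewrite /slot_interval mem_interval//= ?ltn_ord// expnB// ltn_ord.
Qed.

(** Since [1 <= j.+1] and [j.+2 <= k], the distance lies between [k ^ (c - i.+1)] and the next power
    of [k], the latter excluded. *)
Lemma slot_interval_level (k c : nat) (s t : node k c) (i : 'I_c) (j : 'I_k.-1) :
  (1 < k)%N -> t \in slot_interval (s, i, j) ->
  trunc_log k (cw_dist s t) = (c - i.+1)%N.
Proof.
move=> k1 /(slot_interval_bounds _ _ _ _ _ _ (ltnW k1)) /andP[lo hi].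
apply: trunc_log_eq => //; rewrite (leq_trans _ lo) ?leq_pmull//=.
rewrite (leq_trans hi)// expnS leq_mul2r -ltn_predRL.
by rewrite ltn_ord orbT.
Qed.

Lemma slot_interval_digit (k c : nat) (s t : node k c) (i : 'I_c) (j : 'I_k.-1) :
  (0 < k)%N -> t \in slot_interval (s, i, j) ->
  (cw_dist s t %/ k ^ (c - i.+1))%N = j.+1.
Proof.
move=> k0 /(slot_interval_bounds _ _ _ _ _ _ k0) /andP[lo hi].
have q0 : (0 < k ^ (c - i.+1))%N by rewrite expn_gt0 k0.
by apply/eqP; rewrite eqn_leq -ltnS ltn_divLR// hi leq_divRL.
Qed.

Lemma slot_interval_inj (k c : nat) (s t : node k c) (y z : 'I_c * 'I_k.-1) :
  (1 < k)%N -> t \in slot_interval (s, y.1, y.2) ->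
  t \in slot_interval (s, z.1, z.2) -> y = z.
Proof.
case: y z => [i j] [i' j'] k1 /= ty tz.
have ii' : i = i'.
  (* As [i.+1 <= c], the truncated subtraction [c - i.+1] loses nothing and determines [i]. *)
  apply/val_inj/succn_inj; rewrite -(subKn (ltn_ord i)) -(subKn (ltn_ord i')).
  by rewrite -(slot_interval_level _ _ _ _ _ _ k1 ty)
             -(slot_interval_level _ _ _ _ _ _ k1 tz).
rewrite -{i'}ii' in tz *; congr (_, _); apply/val_inj/succn_inj.
by rewrite -(slot_interval_digit _ _ _ _ _ _ (ltnW k1) ty)
           (slot_interval_digit _ _ _ _ _ _ (ltnW k1) tz).
Qed.

Lemma out_degree_record_network (k c : nat) (T : Type)
    (X : slot k c -> T -> node k c) (w : T) (s : node k c) :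
  (1 < k)%N -> (forall x, X x w \in slot_interval x) ->
  out_degree (record_network X w) s = (c * k.-1)%N.
Proof.
move=> k1 Xmem; pose f (y : 'I_c * 'I_k.-1) := X (s, y.1, y.2) w.
have f_inj : injective f.
  (* A common target of two slots would lie in both their intervals. *)
  move=> y z fyz; apply: (slot_interval_inj k c s (f y)) => //; first exact: Xmem.
  by rewrite fyz; apply: Xmem.
have -> : (c * k.-1)%N = #|codom f| by rewrite card_codom// card_prod !card_ord.
rewrite /out_degree cardsE; apply: eq_card => t.
apply/existsP/codomP => [[i /existsP[j /eqP <-]]|[[i j] ->]]; first by exists (i, j).
by exists i; apply/existsP; exists j.
Qed.

Lemma logb_natX (R : realType) (k c : nat) :
  (1 < k)%N -> logb (k%:R : R) (k ^ c)%:R = c%:R.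
Proof.
move=> k1; have lnk : ln (k%:R : R) != 0 by rewrite gt_eqF// ln_gt0// ltr1n.
by rewrite /logb natrX lnXn ?ltr0n ?(ltnW k1)// -[ln _ *+ _]mulr_natl mulfK.
Qed.

Theorem theorem1 (R : realType) :
  exists c1 c2 : R, [/\ 0 < c1, c1 <= c2 &
    forall (k c : nat), (2 <= k)%N -> (1 <= c)%N ->
    forall (d : measure_display) (T : measurableType d) (P : probability T R)
      (X : slot k c -> T -> node k c), record_choice P X ->
    forall (w : T) (s : node k c),
      c1 * (k%:R * logb k%:R (k ^ c)%:R)
        <= (out_degree (record_network X w) s)%:R
        <= c2 * (k%:R * logb k%:R (k ^ c)%:R)].
Proof.
(* The degree is [c * (k - 1)], and [k / 2 <= k - 1 <= k] for [k >= 2], with equality on the left at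
   [k = 2]. *)
exists 2^-1, 1; split; [lra | lra |].
move=> k c k2 _ d T P X [Xmem _ _ _] w s.
rewrite logb_natX// out_degree_record_network//.
have k2R : 2 <= k%:R :> R by rewrite ler_nat.
have c0 : 0 <= c%:R :> R by [].
rewrite natrM -subn1 natrB ?(ltnW k2)//.
by apply/andP; split; nra.
Qed.
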